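(* Let $p\in\mathbb{N}$ and $\alpha,\beta\in\mathbb{R}$ be such that $|\alpha|\neq|\beta|$. Then the improper integral $$\mathcal{K}_{p,1}(\alpha,\beta)=\int_0^\infty\frac{(\sin\alpha x-\sin\beta x)^p}{x}\,dx$$ converges if and only if $p$ is odd.
   Context: $\mathbb{N}=\{1,2,3,\ldots\}$. The integral is an improper (Riemann) integral at both endpoints: it converges if $\int_\varepsilon^R$ of the integrand tends to a finite limit as $\varepsilon\to0^+$ and $R\to\infty$ independently, and it diverges otherwise. *)

(* Defs.v *)
From Stdlib Require Import Reals.
From Coquelicot Require Import Coquelicot.
Open Scope R_scope.

Definition K_integrand (p q : nat) (alpha beta x : R) : R :=
  (sin (alpha * x) - sin (beta * x)) ^ p / x ^ q.

(* [filter_prod], used inside [ex_RInt_gen], makes the two endpoints tend to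
   0+ and to +oo independently. *)
Definition improper_integral_converges (f : R -> R) : Prop :=
  ex_RInt_gen f (at_right 0) (Rbar_locally p_infty).

(* Main.v *)
Require Import Defs.
From Stdlib Require Import Reals Lra Lia.
From Coquelicot Require Import Coquelicot.
Open Scope R_scope.

(** Put [f x = sin (alpha x) - sin (beta x)].

    For odd [p], write [f ^ p] as [f ^ (2 k) * f].  The product-to-sum formulas
    turn this into a linear combination of functions [sin (c x)], and each
    [sin (c x) / x] has a convergent Dirichlet integral: it is bounded near [0],
    and integration by parts controls its tail ([converges_sin_div]).  The
    induction on [k] is carried out on the statement that [g x * sin (c x) / x]
    converges for every frequency [c], since this property of [g] is stable under
    multiplication by a cosine ([converges_times_sines_cos]), hence by [f ^ 2].

    For even [p = 2 (k + 1)] the integrand is nonnegative, and [f ^ 2] has a mean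
    value [M >= 1/2]: because [|alpha| <> |beta|], [f ^ 2 - M] is a combination of
    cosines of nonzero frequencies and so has a bounded primitive
    ([sin_diff_sq_mean]).  The elementary inequality
    [t ^ (k + 1) >= e ^ k * (t - e)] with [e = 1/4] carries the positive mean over
    to [f ^ p], so the integral of [f ^ p / x] over [[T, 2 T]] stays above a
    positive constant as [T] grows ([even_power_block]), against Cauchy's
    criterion ([improper_integral_tail]). *)

(** * Cauchy's criterion for the improper integral *)

Lemma ex_RInt_continuous_pos (f : R -> R) (a b : R) :
  (forall x, 0 < x -> continuous f x) -> 0 < a -> 0 < b -> ex_RInt f a b.
Proof.
  intros Hf Ha Hb. apply (ex_RInt_continuous (V := R_CompleteNormedModule)).
  intros z [Hz _]. apply Hf.
  apply Rlt_le_trans with (2 := Hz). now apply Rmin_glb_lt.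
Qed.

(** Cauchy's criterion compares endpoints in no particular order, while estimates
    of integrals are natural for ordered ones. *)
Lemma RInt_small_unordered (f : R -> R) (P : R -> Prop) (eps : R) :
  (forall x, 0 < x -> continuous f x) ->
  (forall a, P a -> 0 < a) ->
  (forall a b, P a -> P b -> a <= b -> Rabs (RInt f a b) <= eps) ->
  forall a b, P a -> P b -> Rabs (RInt f a b) <= eps.
Proof.
  intros Hf HP H a b Ha Hb. destruct (Rle_dec a b) as [Hab|Hab].
  - now apply H.
  - replace (RInt f a b) with (- RInt f b a).
    + rewrite Rabs_Ropp. apply H; try assumption. lra.
    + apply (opp_RInt_swap f b a). apply ex_RInt_continuous_pos; auto.
Qed.

Lemma improper_integral_cauchy (f : R -> R) :
  (forall x, 0 < x -> continuous f x) ->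
  (forall eps : posreal, exists d, 0 < d /\
     forall a b, 0 < a < d -> 0 < b < d -> a <= b -> Rabs (RInt f a b) <= eps) ->
  (forall eps : posreal, exists M, 0 < M /\
     forall a b, M < a -> M < b -> a <= b -> Rabs (RInt f a b) <= eps) ->
  improper_integral_converges f.
Proof.
  intros Hf H0 Hinf.
  set (F := filter_prod (at_right 0) (Rbar_locally p_infty)).
  assert (Hlim : exists y : R,
             filterlim (fun ab => RInt f (fst ab) (snd ab)) F (locally y)).
  { apply (filterlim_locally_cauchy (U := R_CompleteSpace)). intros eps.
    destruct (H0 (pos_div_2 (pos_div_2 eps))) as [d [Hd Hda]].
    destruct (Hinf (pos_div_2 (pos_div_2 eps))) as [M [HM HMa]].
    exists (fun ab => 0 < fst ab < d /\ M < snd ab). split.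
    - apply Filter_prod with (Q := fun a => 0 < a < d) (R := fun b => M < b).
      + exists (mkposreal d Hd). intros y Hy Hy0.
        change (Rabs (y - 0) < d) in Hy. rewrite Rminus_0_r in Hy.
        apply Rabs_lt_between in Hy. lra.
      + now exists M.
      + now intros.
    - intros [a b] [a' b'] [Ha Hb] [Ha' Hb']. simpl in *.
      assert (HA : Rabs (RInt f a' a) <= eps / 2 / 2)
        by (apply (RInt_small_unordered f (fun t => 0 < t < d)); trivial;
            intros; lra).
      assert (HB : Rabs (RInt f b b') <= eps / 2 / 2)
        by (apply (RInt_small_unordered f (fun t => M < t)); trivial;
            intros; lra).
      assert (E : RInt f a' b' = RInt f a' a + RInt f a b + RInt f b b').
      { rewrite <- (RInt_Chasles f a' b b'), <- (RInt_Chasles f a' a b);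
          try apply ex_RInt_continuous_pos; trivial; lra. }
      change (Rabs (RInt f a' b' - RInt f a b) < eps).
      rewrite E.
      replace (RInt f a' a + RInt f a b + RInt f b b' - RInt f a b)
        with (RInt f a' a + RInt f b b') by ring.
      apply Rle_lt_trans with (1 := Rabs_triang _ _).
      pose proof (cond_pos eps). lra. }
  destruct Hlim as [y Hy]. exists y.
  apply filterlimi_locally. intros eps.
  assert (Hball : F (fun ab => ball y eps (RInt f (fst ab) (snd ab))))
    by (apply Hy; now exists eps).
  assert (Hpos : F (fun ab => 0 < fst ab /\ 0 < snd ab)).
  { apply Filter_prod with (Q := fun a => 0 < a) (R := fun b => 0 < b).
    - exists (mkposreal 1 Rlt_0_1). now intros.
    - now exists 0.
    - now intros. }
  generalize (filter_and _ _ Hball Hpos). apply filter_imp.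
  intros [a b] [Hab [Ha Hb]]. exists (RInt f a b). split; trivial.
  apply (RInt_correct f). now apply ex_RInt_continuous_pos.
Qed.

Lemma improper_integral_tail (f : R -> R) (eps : posreal) :
  improper_integral_converges f ->
  exists M, forall a b, M < a -> M < b -> Rabs (RInt f a b) < eps.
Proof.
  intros [l Hl].
  pose proof (proj1 (filterlimi_locally _ _) Hl (pos_div_2 eps)) as H.
  destruct H as [Q P HQ [M HM] HQP].
  destruct (filter_ex Q HQ) as [z Hz].
  exists M. intros a b Ha Hb.
  destruct (HQP z a Hz (HM a Ha)) as [ya [Hya Ba]].
  destruct (HQP z b Hz (HM b Hb)) as [yb [Hyb Bb]]. simpl in Hya, Hyb.
  assert (E : RInt f a b = - ya + yb).
  { apply is_RInt_unique. apply (is_RInt_Chasles f a z b (- ya) yb); trivial.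
    now apply (is_RInt_swap f). }
  change (Rabs (ya - l) < eps / 2) in Ba. change (Rabs (yb - l) < eps / 2) in Bb.
  rewrite E. apply Rabs_lt_between in Ba. apply Rabs_lt_between in Bb.
  apply Rabs_lt_between. lra.
Qed.

Lemma improper_integral_ext (f g : R -> R) :
  (forall x, 0 < x -> f x = g x) ->
  improper_integral_converges f -> improper_integral_converges g.
Proof.
  intros E. apply ex_RInt_gen_ext.
  apply Filter_prod with (Q := fun a => 0 < a) (R := fun b => 0 < b).
  - exists (mkposreal 1 Rlt_0_1). now intros.
  - now exists 0.
  - intros a b Ha Hb x [Hx _]. apply E.
    apply Rlt_trans with (2 := Hx). now apply Rmin_glb_lt.
Qed.

Lemma improper_integral_linear (k : R) (f g : R -> R) :
  improper_integral_converges f -> improper_integral_converges g ->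
  improper_integral_converges (fun x => k * f x + g x).
Proof.
  intros [lf Hf] [lg Hg]. exists (k * lf + lg).
  apply (is_RInt_gen_plus (fun x => k * f x) g (k * lf) lg); trivial.
  now apply (is_RInt_gen_scal f k lf).
Qed.

(** * Convergence for odd exponents *)

Lemma Rabs_sin_le (y : R) : Rabs (sin y) <= Rabs y.
Proof.
  assert (H : forall y, 0 <= y -> Rabs (sin y) <= y).
  { clear y. intros y [Hy|Hy].
    - destruct (Rle_dec y 1) as [H1|H1].
      + pose proof (sin_lt_x y Hy). pose proof PI2_1.
        assert (0 <= sin y) by (apply sin_ge_0; lra).
        rewrite Rabs_pos_eq; lra.
      + pose proof (SIN_bound y). apply Rabs_le_between. lra.
    - rewrite <- Hy, sin_0, Rabs_R0. lra. }
  destruct (Rle_dec 0 y) as [Hy|Hy].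
  - rewrite (Rabs_pos_eq y) by trivial. auto.
  - rewrite <- Rabs_Ropp, <- sin_neg, (Rabs_left y) by lra. apply H. lra.
Qed.

(** Integration by parts with the primitive [1 - cos (c x)] of [c * sin (c x)]:
    the remaining integrand [(1 - cos (c x)) / x ^ 2] lies between [0] and
    [2 / x ^ 2].  Comparing with the derivatives of [(1 - cos (c x)) / x] and of
    [(1 - cos (c x)) / x - 2 / x] expresses this without a second integral. *)
Lemma sin_div_tail (c a b : R) :
  0 < a -> a <= b -> Rabs (RInt (fun x => c * (sin (c * x) / x)) a b) <= 2 / a.
Proof.
  intros Ha Hab.
  set (v := fun x => (1 - cos (c * x)) / x).
  set (dv := fun x => c * (sin (c * x) / x) - (1 - cos (c * x)) / x ^ 2).
  set (w := fun x => v x - 2 / x).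
  set (dw := fun x => dv x + 2 / x ^ 2).
  assert (Hv : is_RInt dv a b (v b - v a)).
  { apply (is_RInt_derive v dv).
    - rewrite Rmin_left, Rmax_right by lra. intros x Hx. unfold v, dv.
      auto_derive; [lra | field; lra].
    - rewrite Rmin_left, Rmax_right by lra. intros x Hx.
      apply (ex_derive_continuous dv). unfold dv. auto_derive. nra. }
  assert (Hw : is_RInt dw a b (w b - w a)).
  { apply (is_RInt_derive w dw).
    - rewrite Rmin_left, Rmax_right by lra. intros x Hx. unfold w, dw, v, dv.
      auto_derive; [lra | field; lra].
    - rewrite Rmin_left, Rmax_right by lra. intros x Hx.
      apply (ex_derive_continuous dw). unfold dw, dv. auto_derive. nra. }
  assert (Hs : ex_RInt (fun x => c * (sin (c * x) / x)) a b).
  { apply ex_RInt_continuous_pos; try lra. intros x Hx.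
    apply (ex_derive_continuous (fun x => c * (sin (c * x) / x))).
    auto_derive. lra. }
  assert (Hh : forall x, a < x < b ->
             0 <= (1 - cos (c * x)) / x ^ 2 <= 2 / x ^ 2).
  { intros x Hx. pose proof (COS_bound (c * x)).
    assert (0 < / x ^ 2) by (apply Rinv_0_lt_compat, pow_lt; lra).
    unfold Rdiv. split; nra. }
  assert (Lo : v b - v a <= RInt (fun x => c * (sin (c * x) / x)) a b).
  { rewrite <- (is_RInt_unique _ _ _ _ Hv).
    apply RInt_le; trivial; [now exists (v b - v a)|].
    intros x Hx. unfold dv. specialize (Hh x Hx). lra. }
  assert (Up : RInt (fun x => c * (sin (c * x) / x)) a b <= w b - w a).
  { rewrite <- (is_RInt_unique _ _ _ _ Hw).
    apply RInt_le; trivial; [now exists (w b - w a)|].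
    intros x Hx. unfold dw, dv. specialize (Hh x Hx). lra. }
  assert (Bv : forall x, 0 < x -> 0 <= v x <= 2 / x).
  { intros x Hx. unfold v. pose proof (COS_bound (c * x)).
    pose proof (Rinv_0_lt_compat x Hx). unfold Rdiv. split; nra. }
  unfold w in Up.
  pose proof (Bv a Ha). assert (Hb : 0 < b) by lra. pose proof (Bv b Hb).
  apply Rabs_le_between. lra.
Qed.

Lemma converges_sin_div (c : R) :
  improper_integral_converges (fun x => sin (c * x) / x).
Proof.
  (* Integration by parts produces the factor [c]; it can be divided out unless
     [c = 0], when the integrand vanishes anyway. *)
  assert (H : improper_integral_converges (fun x => c * (sin (c * x) / x))).
  { assert (Hc : forall x, 0 < x -> continuous (fun x => c * (sin (c * x) / x)) x).
    { intros x Hx. apply (ex_derive_continuous (fun x => c * (sin (c * x) / x))).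
      auto_derive. lra. }
    assert (Hc2 : 0 < c ^ 2 + 1) by nra.
    apply improper_integral_cauchy; trivial; intros eps;
      pose proof (cond_pos eps) as Heps.
    - exists (eps / (c ^ 2 + 1)). split; [now apply Rdiv_lt_0_compat|].
      intros a b Ha Hb Hab.
      apply Rle_trans with ((b - a) * (c ^ 2 + 1)).
      + apply abs_RInt_le_const; trivial; [apply ex_RInt_continuous_pos; tauto|].
        intros t Ht. rewrite Rabs_mult. unfold Rdiv. rewrite Rabs_mult.
        pose proof (Rabs_sin_le (c * t)) as Hs. rewrite Rabs_mult in Hs.
        rewrite Rabs_inv, (Rabs_pos_eq t) in * by lra.
        apply Rle_trans with (Rabs c * (Rabs c * t * / t)).
        * apply Rmult_le_compat_l; [apply Rabs_pos|].
          apply Rmult_le_compat_r; trivial.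
          apply Rlt_le, Rinv_0_lt_compat. lra.
        * rewrite Rmult_assoc, Rinv_r, Rmult_1_r by lra.
          rewrite <- Rabs_mult, Rabs_pos_eq; nra.
      + replace (pos eps) with (eps / (c ^ 2 + 1) * (c ^ 2 + 1)) by (field; lra).
        apply Rmult_le_compat_r; lra.
    - assert (0 < 2 / eps) by (apply Rdiv_lt_0_compat; lra).
      exists (2 / eps). split; trivial. intros a b Ha Hb Hab.
      assert (Ha0 : 0 < a) by lra.
      apply Rle_trans with (1 := sin_div_tail c a b Ha0 Hab).
      apply (Rmult_lt_compat_r eps) in Ha; trivial.
      replace (2 / eps * eps) with 2 in Ha by (field; lra).
      apply (Rmult_le_reg_r a); [lra|].
      replace (2 / a * a) with 2 by (field; lra). nra. }
  destruct (Req_dec c 0) as [->|Hc].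
  - apply improper_integral_ext with (2 := H).
    intros x _. rewrite !Rmult_0_l, sin_0. lra.
  - apply improper_integral_ext with
      (2 := improper_integral_linear (/ c - 1) _ _ H H).
    intros x Hx. field. lra.
Qed.

Definition converges_times_sines (g : R -> R) : Prop :=
  forall c, improper_integral_converges (fun x => g x * sin (c * x) / x).

Lemma converges_times_sines_linear (k : R) (g h : R -> R) :
  converges_times_sines g -> converges_times_sines h ->
  converges_times_sines (fun x => k * g x + h x).
Proof.
  intros Hg Hh c.
  apply improper_integral_ext with
    (2 := improper_integral_linear k _ _ (Hg c) (Hh c)).
  intros x Hx. field. lra.
Qed.

Lemma converges_times_sines_cos (g : R -> R) (d : R) :
  converges_times_sines g -> converges_times_sines (fun x => g x * cos (d * x)).
Proof.
  intros Hg c.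
  (* The mean [u / 2 + v / 2] is reached as [u / 2 + (- v / 2 + v)]. *)
  pose proof (improper_integral_linear (-1/2) _ _ (Hg (c + d)) (Hg (c + d))) as H1.
  apply improper_integral_ext with
    (2 := improper_integral_linear (1/2) _ _ (Hg (c - d)) H1).
  intros x Hx. cbv beta.
  rewrite !Rmult_plus_distr_r, Rmult_minus_distr_r, sin_plus, sin_minus.
  field. lra.
Qed.

Lemma sin_diff_sq (a b x : R) :
  (sin (a * x) - sin (b * x)) ^ 2 =
  1 - cos (2 * a * x) / 2 - cos (2 * b * x) / 2
  - cos ((a - b) * x) + cos ((a + b) * x).
Proof.
  rewrite Rmult_plus_distr_r, Rmult_minus_distr_r, cos_plus, cos_minus.
  rewrite !Rmult_assoc, !cos_2a_sin. field.
Qed.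

Lemma converges_times_sines_sq (g : R -> R) (a b : R) :
  converges_times_sines g ->
  converges_times_sines (fun x => g x * (sin (a * x) - sin (b * x)) ^ 2).
Proof.
  intros Hg c.
  pose proof (converges_times_sines_cos g) as Hcos.
  pose proof (converges_times_sines_linear (-1/2) _ _ (Hcos (2 * a) Hg) Hg) as H.
  apply (converges_times_sines_linear (-1/2) _ _ (Hcos (2 * b) Hg)) in H.
  apply (converges_times_sines_linear (-1) _ _ (Hcos (a - b) Hg)) in H.
  apply (converges_times_sines_linear 1 _ _ (Hcos (a + b) Hg)) in H.
  apply improper_integral_ext with (2 := H c).
  intros x Hx. cbv beta. rewrite sin_diff_sq. field. lra.
Qed.

Lemma converges_times_sines_even_power (a b : R) (k : nat) :
  converges_times_sines (fun x => (sin (a * x) - sin (b * x)) ^ (2 * k)).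
Proof.
  induction k as [|k IH]; intros c.
  - apply improper_integral_ext with (2 := converges_sin_div c).
    intros x Hx. simpl. field. lra.
  - apply improper_integral_ext with (2 := converges_times_sines_sq _ a b IH c).
    intros x Hx. replace (2 * S k)%nat with (2 * k + 2)%nat by lia.
    now rewrite pow_add.
Qed.

Lemma converges_odd (a b : R) (k : nat) :
  improper_integral_converges (fun x => K_integrand (2 * k + 1) 1 a b x).
Proof.
  pose proof (converges_times_sines_even_power a b k) as H.
  apply improper_integral_ext with
    (2 := improper_integral_linear (-1) _ _ (H b) (H a)).
  intros x Hx. unfold K_integrand. rewrite pow_add, !pow_1. field. lra.
Qed.

(** * Divergence for even exponents *)

(** Bounded primitives characterise, among trigonometric polynomials, those
    without constant term. *)
Definition has_bounded_primitive (g : R -> R) : Prop :=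
  exists F C, forall x, is_derive F x (g x) /\ Rabs (F x) <= C.

Lemma has_bounded_primitive_linear (k : R) (g h : R -> R) :
  has_bounded_primitive g -> has_bounded_primitive h ->
  has_bounded_primitive (fun x => k * g x + h x).
Proof.
  intros [F [C HF]] [G [D HG]].
  exists (fun x => k * F x + G x), (Rabs k * C + D). intros x.
  destruct (HF x) as [HF1 HF2], (HG x) as [HG1 HG2]. split.
  - apply (is_derive_plus (fun x => k * F x) G); trivial.
    now apply (is_derive_scal F).
  - apply Rle_trans with (1 := Rabs_triang _ _). rewrite Rabs_mult.
    apply Rplus_le_compat; trivial. apply Rmult_le_compat_l; trivial.
    apply Rabs_pos.
Qed.

Lemma has_bounded_primitive_ext (g h : R -> R) :
  (forall x, g x = h x) -> has_bounded_primitive g -> has_bounded_primitive h.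
Proof.
  intros E [F [C HF]]. exists F, C. intros x. rewrite <- E. apply HF.
Qed.

Lemma has_bounded_primitive_cos (c : R) :
  c <> 0 -> has_bounded_primitive (fun x => cos (c * x)).
Proof.
  intros Hc. exists (fun x => / c * sin (c * x)), (Rabs (/ c)). intros x. split.
  - auto_derive; trivial. field. trivial.
  - rewrite Rabs_mult. rewrite <- (Rmult_1_r (Rabs (/ c))) at 2.
    apply Rmult_le_compat_l; [apply Rabs_pos|].
    apply Rabs_le_between, SIN_bound.
Qed.

(** When one frequency is [0], the square is [(1 - cos (2 c x)) / 2], of mean
    [1/2]; otherwise none of the four cosines in [sin_diff_sq] degenerates and
    the mean is [1]. *)
Lemma sin_diff_sq_mean (a b : R) :
  Rabs a <> Rabs b ->
  exists M, 1 / 2 <= M /\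
    has_bounded_primitive (fun x => (sin (a * x) - sin (b * x)) ^ 2 - M).
Proof.
  intros Hab.
  assert (Hm : a - b <> 0) by (intros E; apply Hab; f_equal; lra).
  assert (Hp : a + b <> 0).
  { intros E. apply Hab. rewrite <- (Rabs_Ropp b). f_equal. lra. }
  assert (H1 : forall c, c <> 0 ->
             has_bounded_primitive (fun x => sin (c * x) ^ 2 - 1 / 2)).
  { intros c Hc.
    assert (H : has_bounded_primitive (fun x => cos (2 * c * x)))
      by (apply has_bounded_primitive_cos; lra).
    (* The coefficient [-1/2] of the cosine is obtained as [-3/2 + 1]. *)
    apply has_bounded_primitive_ext with
      (2 := has_bounded_primitive_linear (-3/2) _ _ H H).
    intros x. cbv beta. rewrite Rmult_assoc, cos_2a_sin. field. }
  destruct (Req_dec a 0) as [->|Ha]; [|destruct (Req_dec b 0) as [->|Hb]].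
  - exists (1 / 2). split; [lra|].
    apply has_bounded_primitive_ext with (2 := H1 b ltac:(lra)).
    intros x. rewrite Rmult_0_l, sin_0. ring.
  - exists (1 / 2). split; [lra|].
    apply has_bounded_primitive_ext with (2 := H1 a Ha).
    intros x. rewrite Rmult_0_l, sin_0. ring.
  - exists 1. split; [lra|].
    pose proof (has_bounded_primitive_cos _ Hm) as Cm.
    pose proof (has_bounded_primitive_cos _ Hp) as Cp.
    pose proof (has_bounded_primitive_linear (-1) _ _ Cm Cp) as H.
    apply (has_bounded_primitive_linear 1 _ _ (H1 b Hb)) in H.
    apply (has_bounded_primitive_linear 1 _ _ (H1 a Ha)) in H.
    apply has_bounded_primitive_ext with (2 := H).
    intros x. cbv beta.
    rewrite sin_diff_sq, (Rmult_assoc 2 a), (Rmult_assoc 2 b), !cos_2a_sin. field.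
Qed.

(** If [t < e] the right-hand side is negative, otherwise [t ^ k >= e ^ k]. *)
Lemma pow_S_ge_affine (t e : R) (k : nat) :
  0 <= t -> 0 <= e -> e ^ k * (t - e) <= t ^ S k.
Proof.
  intros Ht He. pose proof (pow_le e k He). pose proof (pow_le t k Ht).
  simpl. destruct (Rle_dec e t) as [Het|Het].
  - assert (e ^ k <= t ^ k) by (apply pow_incr; lra). nra.
  - nra.
Qed.

(** On [[T, 2 T]] the factor [1 / x] is at least [1 / (2 T)], which compensates
    exactly the length of the interval: the bound does not decay with [T]. *)
Lemma even_power_block (a b : R) (k : nat) :
  Rabs a <> Rabs b ->
  exists T0, 0 < T0 /\ forall T, T0 <= T ->
    (1 / 4) ^ k / 16 <= RInt (fun x => K_integrand (2 * S k) 1 a b x) T (2 * T).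
Proof.
  intros Hab.
  destruct (sin_diff_sq_mean a b Hab) as [M [HM [F [C HF]]]].
  assert (HC : 0 <= C)
    by (apply Rle_trans with (2 := proj2 (HF 0)), Rabs_pos).
  (* The oscillating part of the primitive contributes at most [2 C] over the
     block, against a growth of at least [T / 4]; half of it is kept. *)
  exists (16 * C + 1). split; [lra|]. intros T HT.
  assert (HT0 : 0 < T) by lra.
  set (e := (1 / 4) ^ k).
  assert (He : 0 < e) by (apply pow_lt; lra).
  set (G := fun x => e / (2 * T) * (F x + (M - 1 / 4) * x)).
  set (dG := fun x => e / (2 * T) * ((sin (a * x) - sin (b * x)) ^ 2 - 1 / 4)).
  assert (HG : is_RInt dG T (2 * T) (G (2 * T) - G T)).
  { apply (is_RInt_derive G dG).
    - intros x _. unfold G, dG. apply is_derive_scal.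
      replace ((sin (a * x) - sin (b * x)) ^ 2 - 1 / 4)
        with ((sin (a * x) - sin (b * x)) ^ 2 - M + (M - 1 / 4)) by ring.
      apply (is_derive_plus F (fun x => (M - 1 / 4) * x)).
      + apply HF.
      + auto_derive; trivial. ring.
    - intros x _. apply (ex_derive_continuous dG). unfold dG. auto_derive. lra. }
  apply Rle_trans with (G (2 * T) - G T).
  - pose proof (proj2 (HF T)) as F1. pose proof (proj2 (HF (2 * T))) as F2.
    apply Rabs_le_between in F1. apply Rabs_le_between in F2.
    replace (G (2 * T) - G T)
      with (e / (2 * T) * (F (2 * T) - F T + (M - 1 / 4) * T))
      by (unfold G; field; lra).
    replace (e / 16) with (e / (2 * T) * (T / 8)) by (field; lra).
    apply Rmult_le_compat_l; [apply Rlt_le, Rdiv_lt_0_compat; lra|]. nra.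
  - rewrite <- (is_RInt_unique _ _ _ _ HG).
    apply RInt_le; [lra | now exists (G (2 * T) - G T) | |].
    + apply ex_RInt_continuous_pos; try lra. intros x Hx.
      apply (ex_derive_continuous (fun x => K_integrand (2 * S k) 1 a b x)).
      unfold K_integrand. auto_derive. simpl. lra.
    + intros x Hx. unfold dG, K_integrand. rewrite pow_1, pow_mult.
      pose proof (pow_S_ge_affine ((sin (a * x) - sin (b * x)) ^ 2) (1 / 4) k
                    (pow2_ge_0 _) ltac:(lra)) as Hpow.
      fold e in Hpow.
      pose proof (pow_le _ (S k) (pow2_ge_0 (sin (a * x) - sin (b * x)))) as Hpos.
      apply Rle_trans with (((sin (a * x) - sin (b * x)) ^ 2) ^ S k / (2 * T)).
      * replace (e / (2 * T) * ((sin (a * x) - sin (b * x)) ^ 2 - 1 / 4))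
          with (e * ((sin (a * x) - sin (b * x)) ^ 2 - 1 / 4) / (2 * T))
          by (field; lra).
        apply Rmult_le_compat_r; trivial.
        apply Rlt_le, Rinv_0_lt_compat. lra.
      * apply Rmult_le_compat_l; trivial. apply Rinv_le_contravar; lra.
Qed.

Lemma diverges_even (a b : R) (k : nat) :
  Rabs a <> Rabs b ->
  ~ improper_integral_converges (fun x => K_integrand (2 * S k) 1 a b x).
Proof.
  intros Hab Hconv.
  assert (He : 0 < (1 / 4) ^ k / 16)
    by (apply Rdiv_lt_0_compat; [apply pow_lt|]; lra).
  destruct (improper_integral_tail _ (mkposreal _ He) Hconv) as [M HM].
  destruct (even_power_block a b k Hab) as [T0 [HT0 HT]].
  set (T := Rmax T0 (M + 1)).
  assert (H1 : T0 <= T) by apply Rmax_l. assert (H2 : M + 1 <= T) by apply Rmax_r.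
  specialize (HM T (2 * T) ltac:(lra) ltac:(lra)). simpl pos in HM.
  specialize (HT T H1). apply Rabs_lt_between in HM. lra.
Qed.

Theorem theorem6p2 (p : nat) (alpha beta : R)
    (hp : (1 <= p)%nat) (hab : Rabs alpha <> Rabs beta) :
  improper_integral_converges (fun x => K_integrand p 1 alpha beta x)
  <-> Nat.Odd p.
Proof.
  split.
  - intros Hconv. destruct (Nat.Even_or_Odd p) as [[m Hm]|Hodd]; trivial.
    destruct m as [|k]; [lia|]. subst p.
    now apply diverges_even in Hconv.
  - intros [k ->]. apply converges_odd.
Qed.
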